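(* Let $\Gamma$ be a set, $\lambda:\Gamma\to\Gamma$ a function, $K$ a non-trivial abelian group, and $\sigma_\lambda:K^\Gamma\to K^\Gamma$ the generalized shift, $\sigma_\lambda((x_i)_{i\in\Gamma})=(x_{\lambda(i)})_{i\in\Gamma}$. The following conditions are equivalent: (a) $\lambda$ is bounded; (b) $\sigma_\lambda$ is quasi-periodic; (c) $\sigma_\lambda$ is locally quasi-periodic.
   Context: $\mathbb N$ contains $0$. Bounded: $\lambda:\Gamma\to\Gamma$ defines a preorder on $\Gamma$ by $i\leq_\lambda j$ iff $\lambda^s(j)=i$ for some $s\in\mathbb N$. A subset $I\subseteq\Gamma$ is totally preordered if for all $i,j\in I$ either $i\leq_\lambda j$ or $j\leq_\lambda i$ (antisymmetry is not required). $\lambda$ is bounded if there exists $N\in\mathbb N$ such that $|I|\leq N$ for every totally preordered subset $I$ of $(\Gamma,\leq_\lambda)$. Quasi-periodicity: for a function $f:X\to X$, a point $x\in X$ is quasi-periodic if $f^{n}(x)=f^{m}(x)$ for some $n<m$ in $\mathbb N$; $f$ is locally quasi-periodic if every point of $X$ is quasi-periodic; $f$ is quasi-periodic if there exist $n<m$ in $\mathbb N$ with $f^n=f^m$. *)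

(* Defs.v *)
From mathcomp Require Import all_boot all_algebra.
From mathcomp Require Import boolp classical_sets functions cardinality.
Set Implicit Arguments.
Unset Strict Implicit.
Unset Printing Implicit Defensive.
Local Open Scope classical_set_scope.

Definition le_iter (G : Type) (lam : G -> G) (i j : G) : Prop :=
  exists s : nat, iter s lam j = i.

Definition totally_preordered (G : Type) (lam : G -> G) (I : set G) : Prop :=
  forall i j : G, I i -> I j -> le_iter lam i j \/ le_iter lam j i.

(* |I| <= N is stated as an injection of I into `I_N = {0, ..., N-1}; in
   particular it forces I to be finite. *)
Definition bounded_map (G : Type) (lam : G -> G) : Prop :=
  exists N : nat, forall I : set G, totally_preordered lam I -> (I #<= `I_N)%card.

Definition quasi_periodic_point (X : Type) (f : X -> X) (x : X) : Prop :=
  exists n m : nat, (n < m)%N /\ iter n f x = iter m f x.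

Definition locally_quasi_periodic (X : Type) (f : X -> X) : Prop :=
  forall x : X, quasi_periodic_point f x.

Definition quasi_periodic (X : Type) (f : X -> X) : Prop :=
  exists n m : nat, (n < m)%N /\ iter n f = iter m f.

Definition generalized_shift (K G : Type) (lam : G -> G) (x : G -> K) : G -> K :=
  fun i => x (lam i).

(* Main.v *)
(** The powers of the shift are [iter n sigma x = x \o iter n lam].  Boundedness
    of [lam] means that all its orbits have at most [N] points for some [N]; then
    each orbit enters a cycle of length dividing [N`!] within [N] steps, so
    [sigma^N = sigma^(N + N`!)].  Conversely, if orbits are arbitrarily long, then
    for [n < m] and any finite set [F] some [i] has
    [iter n lam i <> iter m lam i] with [iter n lam i] outside [F].  Enumerating the
    pairs [(n, m)], one decides membership in a set [S] on finitely many points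
    at a time so that, for each pair, [S] separates [iter n lam i] from
    [iter m lam i] for some [i].  The point equal to [a <> 0] on [S] and to [0]
    elsewhere is then not quasi-periodic. *)
Require Import Defs.
From mathcomp Require Import all_boot all_algebra.
From mathcomp Require Import boolp classical_sets functions cardinality.

Local Open Scope ring_scope.

(** Turns a cardinality bound, which also asserts finiteness, into a test on duplicate-free lists;
    an infinite set fails it because it contains [N.+1] distinct elements. *)
Lemma card_le_II_seqP (T : choiceType) (A : set T) (N : nat) :
  (A #<= `I_N)%card <->
  forall s : seq T, uniq s -> (forall x, x \in s -> A x) -> (size s <= N)%N.
Proof.
split=> [AN s us sA|sizeN].
  case: s us sA => [//|x0 s'] us sA; set s := x0 :: s' in us sA *.
  rewrite -card_le_II; apply: card_le_trans AN.
  have /injfunPex[f] : exists2 f : nat -> T,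
      set_fun `I_(size s)%classic A f & set_inj `I_(size s)%classic f.
    exists (nth x0 s) => [i /= si|i j]; first exact/sA/mem_nth.
    by rewrite !inE => si sj /eqP; rewrite nth_uniq// => /eqP.
  exact: inj_card_le.
have finA : finite_set A.
  apply: contrapT => /(@infinite_set_fset _ _ N.+1)[B BA].
  by apply/negP; rewrite -ltnNge ltnS sizeN ?finmap.fset_uniq.
have /finite_seqP[s As] := finA.
have size_s : (size (undup s) <= N)%N.
  by apply: (sizeN _ (undup_uniq s)) => x; rewrite As mem_undup.
have /injfunPex[f] : exists2 f : T -> nat, set_fun A `I_N%classic f & set_inj A f.
  exists (index^~ (undup s)) => [x|x y /set_mem + /set_mem]; rewrite As /= => xs.
    by rewrite (leq_trans _ size_s)// index_mem mem_undup.
  by move=> ys; apply: (@index_inj _ x (undup s)); rewrite mem_undup.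
exact: inj_card_le.
Qed.

Lemma le_iter_trans (G : Type) (lam : G -> G) (i j k : G) :
  le_iter lam i j -> le_iter lam j k -> le_iter lam i k.
Proof. by move=> [s <-] [t <-]; exists (s + t)%N; rewrite iterD. Qed.

(** Puts a finite totally preordered list inside the forward orbit of one of its own elements. *)
Lemma totally_preordered_top (G : eqType) (lam : G -> G) (I : set G)
    (x0 : G) (s : seq G) :
  totally_preordered lam I -> (forall x, x \in x0 :: s -> I x) ->
  exists2 i, i \in x0 :: s & forall x, x \in x0 :: s -> le_iter lam x i.
Proof.
move=> tI; elim: s x0 => [|y s IHs] x0 sI.
  by exists x0; rewrite ?mem_head// => x /[1!inE] /eqP ->; exists 0%N.
have [x xs|i is_ lei] := IHs y; first by apply: sI; rewrite inE xs orbT.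
have Ix0 : I x0 by apply: sI; rewrite mem_head.
have Ii : I i by apply: sI; rewrite inE is_ orbT.
have [le0|le0] := tI _ _ Ix0 Ii.
- exists i => [|x]; first by rewrite inE is_ orbT.
  by rewrite inE => /predU1P[->|/lei].
- exists x0 => [|x]; first by rewrite mem_head.
  rewrite inE => /predU1P[->|/lei lex]; last exact: le_iter_trans lex le0.
  by exists 0%N.
Qed.

Lemma totally_preordered_traject (G : eqType) (lam : G -> G) (i : G) (n : nat) :
  totally_preordered lam [set` traject lam i n].
Proof.
have le_traj (a b : nat) : (a <= b)%N -> le_iter lam (iter b lam i) (iter a lam i).
  by move=> ab; exists (b - a)%N; rewrite -iterD subnK.
move=> _ _ /trajectP[a _ ->] /trajectP[b _ ->].
by have [/le_traj|/ltnW/le_traj] := leqP a b; [right|left].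
Qed.

(** [looping lam i N] says that the orbit of [i] has at most [N] points. Orbit segments are totally
    preordered, and conversely a finite totally preordered list lies in the orbit of its top
    element. *)
Lemma bounded_map_looping (G : choiceType) (lam : G -> G) :
  bounded_map lam <-> exists N : nat, forall i, looping lam i N.
Proof.
split=> -[N bN]; exists N; [move=> i|move=> I tI].
  apply/negPn; rewrite -looping_uniq; apply/negP => ut.
  have /card_le_II_seqP/(_ _ ut) := bN _ (@totally_preordered_traject _ lam i N.+1).
  by rewrite size_traject ltnn => /(_ (fun _ => id)).
apply/card_le_II_seqP => -[//|x0 s] us sI.
have [i _ lei] := totally_preordered_top _ _ _ _ _ tI sI.
rewrite -(size_traject lam i N); apply: uniq_leq_size us _ => x /lei[k <-].
exact/loopingP.
Qed.

(** If [iter N lam i = iter j lam i] with [j < N], then [iter N lam i] is fixed by [N - j] further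
    steps, and [N - j] divides the factorial of [N]. *)
Lemma looping_periodic (G : eqType) (lam : G -> G) (N : nat) (i : G) :
  looping lam i N -> iter (N + N`!)%N lam i = iter N lam i.
Proof.
move=> /trajectP[j jN ji]; rewrite addnC iterD.
have /dvdnP[q ->] : (N - j %| N`!)%N by apply: dvdn_fact; rewrite subn_gt0 jN leq_subr.
by rewrite iterM iter_fix// {1}ji -iterD subnK// ltnW.
Qed.

(** Requirements are met one at a time. At stage [k] the point [u] is still undecided while [v] may
    already be decided, so [u] is put in [S] exactly when [v] is not. *)
Lemma separating_set (G : eqType) (E : nat -> G -> G -> Prop) :
  (forall k (F : seq G), exists u v, [/\ E k u v, u <> v & u \notin F]) ->
  exists S : set G, forall k, exists u v, E k u v /\ (S u <-> ~ S v).
Proof.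
move=> exE.
have /choice[w wP] : forall kF : nat * seq G,
    exists p : G * G, [/\ E kF.1 p.1 p.2, p.1 <> p.2 & p.1 \notin kF.2].
  by move=> [k F]; have [u [v]] := exE k F; exists (u, v).
(* [(d k).1] is the finite set of points decided before stage [k], and
   [(d k).2] those among them that were put in [S]. *)
pose step k (FS : seq G * seq G) :=
  let: (u, v) := w (k, FS.1) in
  (u :: v :: FS.1, if v \in FS.2 then FS.2 else u :: FS.2).
pose d := fix d k := if k is k'.+1 then step k' (d k') else ([::], [::]).
have dS k : d k.+1 = let: (u, v) := w (k, (d k).1) in
  (u :: v :: (d k).1, if v \in (d k).2 then (d k).2 else u :: (d k).2) by [].
have SF k : {subset (d k).2 <= (d k).1}.
  elim: k => // k IHk x; rewrite dS; case: (w _) => u v /=; rewrite !inE.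
  by case: ifP => _; rewrite ?inE; [|case/predU1P => [->|]]; rewrite ?eqxx// => /IHk ->;
    rewrite !orbT.
have F1 k x : x \in (d k).1 -> x \in (d k.+1).1.
  by rewrite dS; case: (w _) => u v /= xF; rewrite !inE xF !orbT.
(* Only the fresh point [u] can be added at stage [k], so earlier decisions stand. *)
have S1 k x : x \in (d k).1 -> (x \in (d k.+1).2) = (x \in (d k).2).
  rewrite dS; have [/= _ _] := wP (k, (d k).1).
  case: (w _) => u v /= uF xF; case: ifP => // _; rewrite inE.
  by case: eqP xF uF => [-> ->|].
have Sstable k l x : x \in (d k).1 ->
    (x \in (d (l + k)%N).2) = (x \in (d k).2) /\ x \in (d (l + k)%N).1.
  by move=> xF; elim: l => // l [eqS Fl]; rewrite addSn S1// eqS F1.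
exists [set x | exists k, x \in (d k).2]%classic => k.
(* Stages [l] and [k.+1] are both compared with the later stage [l + k.+1]. *)
have inS x : x \in (d k.+1).1 ->
    (exists l, x \in (d l).2) <-> x \in (d k.+1).2.
  move=> xF; split=> [[l xl]|]; last by exists k.+1.
  rewrite -(Sstable k.+1 l x xF).1 addnC.
  by rewrite (Sstable l k.+1 x (SF _ _ xl)).1.
have [/= Ek] := wP (k, (d k).1).
move: inS; rewrite dS; case: (w _) Ek => u v /= Ek inS uv uF.
exists u, v; split=> //=.
rewrite !inS ?inE ?eqxx ?orbT//.
have uS : u \notin (d k).2 by apply: contra uF; exact: SF.
case: ifP => vS; first by rewrite vS (negPf uS); split=> // /(_ isT).
by rewrite !inE eqxx vS orbF; split=> // _ /eqP/esym.
Qed.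

Lemma iter_generalized_shift (K G : Type) (lam : G -> G) (n : nat) (x : G -> K) :
  iter n (generalized_shift lam) x = fun i => x (iter n lam i).
Proof.
by elim: n => //= n ->; apply/funext => i; rewrite /generalized_shift -iterSr.
Qed.

(** On an orbit whose iterates up to [m + size F] are distinct, the [size F + 1] points
    [iter (n + j) lam i] with [j <= size F] cannot all lie in [F]; the witness is [iter j lam i] for
    one that does not. *)
Lemma separated_iterates (G : eqType) (lam : G -> G) (n m : nat) (F : seq G) :
  (forall N, exists i, ~ looping lam i N) -> (n < m)%N ->
  exists i, iter n lam i <> iter m lam i /\ iter n lam i \notin F.
Proof.
move=> unb nm; have [i /negP] := unb (m + size F)%N.
rewrite -looping_uniq => ui.
have inj_iter a b : (a <= m + size F)%N -> (b <= m + size F)%N ->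
    iter a lam i = iter b lam i -> a = b.
  move=> aN bN /eqP.
  rewrite -(nth_traject lam (n := (m + size F).+1)) ?ltnS//.
  rewrite -[X in _ == X](nth_traject lam (n := (m + size F).+1)) ?ltnS//.
  by rewrite nth_uniq ?size_traject ?ltnS// => /eqP.
pose s := [seq iter (n + j)%N lam i | j <- iota 0 (size F).+1].
have us : uniq s.
  rewrite map_inj_in_uniq ?iota_uniq// => a b; rewrite !mem_iota !add0n !ltnS /=.
  move=> aF bF eq_ab; apply/eqP; rewrite -(eqn_add2l n); apply/eqP.
  by apply: inj_iter eq_ab; rewrite leq_add// ltnW.
have [sF|/allPn[_ /mapP[j /[!mem_iota] /= jF ->] nF]] := boolP (all (mem F) s).
  have := uniq_leq_size us (allP sF).
  by rewrite size_map size_iota ltnn.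
rewrite add0n ltnS in jF.
exists (iter j lam i); rewrite -!iterD; split=> // eq_nm.
suff /eqP : (n + j)%N = (m + j)%N by rewrite eqn_add2r ltn_eqF.
by apply: inj_iter eq_nm; rewrite leq_add// ltnW.
Qed.

Lemma bounded_map_quasi_periodic (G : choiceType) (K : Type) (lam : G -> G) :
  bounded_map lam -> quasi_periodic (@generalized_shift K G lam).
Proof.
move=> /bounded_map_looping[N loopN]; exists N, (N + N`!)%N; split.
  by rewrite -[ltnLHS]addn0 ltn_add2l fact_gt0.
apply/funext => x; rewrite !iter_generalized_shift; apply/funext => i.
by rewrite looping_periodic.
Qed.

Lemma locally_quasi_periodic_bounded_map (G : choiceType) (K : Type) (lam : G -> G)
    (a b : K) :
  a <> b -> locally_quasi_periodic (@generalized_shift K G lam) -> bounded_map lam.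
Proof.
move=> ab lqp; apply: contrapT => /bounded_map_looping unb.
have {}unb N : exists i, ~ looping lam i N.
  by apply/existsNP => loopN; apply: unb; exists N.
(* Requirement [k] is vacuous unless [k] codes a pair [n < m]. *)
pose E k u v := forall n m, unpickle k = Some (n, m) -> (n < m)%N ->
  exists i, u = iter n lam i /\ v = iter m lam i.
have [k F|S SE] := separating_set _ E.
  (* For such a vacuous [k], the default pair [(0, 1)] still supplies distinct points with the first
     outside [F]. *)
  pose p : nat * nat := odflt (0, 1)%N (unpickle k).
  pose q := if (p.1 < p.2)%N then p else (0, 1)%N.
  have [i [neq nF]] : exists i, iter q.1 lam i <> iter q.2 lam i /\ iter q.1 lam i \notin F.
    by apply: separated_iterates => //; rewrite /q; case: ifP.
  exists (iter q.1 lam i), (iter q.2 lam i); split=> // n m knm nm.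
  by exists i; rewrite /q /p knm /= nm.
have [n [m [nm]]] := lqp (fun g => if `[< S g >] then a else b).
rewrite !iter_generalized_shift.
have [u [v [/(_ n m (pickleK _) nm)[i [-> ->]] Suv]]] := SE (pickle (n, m)).
move=> /(congr1 (@^~ i)); case: asboolP => Su; case: asboolP => Sv //.
- by move=> _; case: (Suv.1 Su).
- by move=> /esym.
- by move=> _; apply: Su; apply/Suv.
Qed.

Theorem theorem4p2 (G : Type) (lam : G -> G) (K : zmodType)
    (K_nontrivial : exists a : K, a != 0) :
  (bounded_map lam <-> quasi_periodic (@generalized_shift K G lam)) /\
  (quasi_periodic (@generalized_shift K G lam) <->
   locally_quasi_periodic (@generalized_shift K G lam)).
Proof.
(* Classically every type carries a choice structure, which gives access to the list arguments
   above. *)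
elim/Pchoice: G => G in lam *.
have [a /eqP a0] := K_nontrivial.
have bq := @bounded_map_quasi_periodic G K lam.
have lb := locally_quasi_periodic_bounded_map _ _ lam _ _ a0.
have ql : quasi_periodic (@generalized_shift K G lam) ->
    locally_quasi_periodic (@generalized_shift K G lam).
  by move=> [n [m [nm eq_nm]]] x; exists n, m; rewrite eq_nm.
by split; split; [|move=> /ql/lb| |move=> /lb/bq].
Qed.
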